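(* Let $0 \le \mu_1 < L_1 < \infty$ and $0 \le \mu_2 < L_2 < \infty$. Given two points $x_1^\star, x_2^\star \in \mathbb{R}^n$, a point $x^\star \in \mathbb{R}^n$ is a minimizer of the sum $f_1(x)+f_2(x)$ for some functions $f_1\in\mathcal{M}_{\mu_1,L_1}(x_1^\star)$ and $f_2\in\mathcal{M}_{\mu_2,L_2}(x_2^\star)$ if and only if $$\left\| (L_1+\mu_1)(x^\star-x_1^\star)+(L_2+\mu_2)(x^\star-x_2^\star) \right\|\leq (L_1-\mu_1)\| x^\star-x_1^\star \|+(L_2-\mu_2)\| x^\star-x_2^\star \|.$$
   Context: $\|\cdot\|$ and $\langle\cdot,\cdot\rangle$ are the Euclidean norm and dot product on $\mathbb{R}^n$. For a convex $f:\mathbb{R}^n\to(-\infty,\infty]$ and $x\in\mathrm{dom}\, f$, $\partial f(x)=\{g: f(y)\ge f(x)+\langle g,y-x\rangle\ \forall y\in\mathbb{R}^n\}$. A convex function $f$ is $L$-smooth ($L\in(0,\infty]$) if $\|g_1-g_2\|\le L\|x_1-x_2\|$ for all $x_1,x_2\in\mathbb{R}^n$, $g_1\in\partial f(x_1)$, $g_2\in\partial f(x_2)$; if $L<\infty$ this means $f$ is differentiable on $\mathbb{R}^n$ with $L$-Lipschitz gradient, and every convex function is regarded as $\infty$-smooth. $f$ is $\mu$-strongly convex ($\mu\ge 0$) if $x\mapsto f(x)-\frac{\mu}{2}\|x\|^2$ is convex. $\mathcal{F}_{\mu,L}(\mathbb{R}^n)$ is the set of closed proper convex functions $\mathbb{R}^n\to(-\infty,\infty]$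 that are $L$-smooth and $\mu$-strongly convex, and $\mathcal{M}_{\mu,L}(z)$ is the set of functions in $\mathcal{F}_{\mu,L}(\mathbb{R}^n)$ for which $z$ is a (global) minimizer. *)

(* Defs.v *)
From mathcomp Require Import all_boot all_order all_algebra.
From mathcomp Require Import all_classical all_reals all_analysis.

Set Implicit Arguments.
Unset Strict Implicit.
Unset Printing Implicit Defensive.

Import Order.TTheory GRing.Theory Num.Theory.
Import numFieldNormedType.Exports.

Local Open Scope classical_set_scope.
Local Open Scope ring_scope.
Local Open Scope ereal_scope.

Section ConvexFunctions.
Variables (R : realType) (n : nat).
Implicit Types (f : 'rV[R]_n -> \bar R) (x y z g : 'rV[R]_n).

Definition dot x y : R := (\sum_(i < n) x ord0 i * y ord0 i)%R.

(* The library norm `|x| on 'rV[R]_n is the sup norm, hence a separate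
   definition; both norms induce the same topology. *)
Definition enorm x : R := Num.sqrt (dot x x).

Definition edom f : set 'rV[R]_n := [set x | f x < +oo].

Definition epigraph f : set ('rV[R]_n * R) := [set p | f p.1 <= p.2%:E].

Definition closed_efun f : Prop := closed (epigraph f).

Definition proper_efun f : Prop :=
  (forall x, f x != -oo) /\ edom f !=set0.

(* The weight t stays in the open interval, so that no term 0 * +oo occurs. *)
Definition convex_efun f : Prop :=
  forall x y (t : R), (0 < t < 1)%R ->
    f (t *: x + (1 - t) *: y)%R <= t%:E * f x + (1 - t)%:E * f y.

Definition subdifferential f x : set 'rV[R]_n :=
  [set g | edom f x /\ forall y, f x + (dot g (y - x)%R)%:E <= f y].

(* The case L = +oo is separate because +oo * 0 = 0 in \bar R: the inequality
   would force subgradients to be unique instead of being vacuous. *)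
Definition smooth_efun (L : \bar R) f : Prop :=
  L = +oo \/
  forall x1 x2 g1 g2, subdifferential f x1 g1 -> subdifferential f x2 g2 ->
    (enorm (g1 - g2)%R)%:E <= L * (enorm (x1 - x2)%R)%:E.

Definition strongly_convex_efun (mu : R) f : Prop :=
  convex_efun (fun x => f x - (mu / 2 * enorm x ^+ 2)%:E).

Definition minimizer f z : Prop := forall y, f z <= f y.

Definition classF (mu : R) (L : \bar R) : set ('rV[R]_n -> \bar R) :=
  [set f | [/\ closed_efun f, proper_efun f, convex_efun f,
               smooth_efun L f & strongly_convex_efun mu f]].

Definition classM (mu : R) (L : \bar R) z : set ('rV[R]_n -> \bar R) :=
  [set f | classF mu L f /\ minimizer f z].

End ConvexFunctions.

(* Main.v *)
Require Import Defs.
From mathcomp Require Import all_boot all_order all_algebra.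
From mathcomp Require Import all_classical all_reals all_analysis.
From mathcomp Require Import ring lra.

Set Implicit Arguments.
Unset Strict Implicit.
Unset Printing Implicit Defensive.

Import Order.TTheory GRing.Theory Num.Theory.
Import numFieldNormedType.Exports.

Local Open Scope classical_set_scope.
Local Open Scope ring_scope.

(** Every function of the class M_(mu,L)(z) is finite and differentiable, and the
    gradients at x of all the functions of the class fill a closed ball:
    some f in M_(mu,L)(z) has g as a subgradient at x if and only if
    [|2 g - (L + mu)(x - z)| <= (L - mu) |x - z|].
    On the other hand x minimizes f1 + f2 exactly when some g is a subgradient
    of f1 at x and - g one of f2 at x.  So x is a minimizer for some choice of
    f1 and f2 if and only if the ball of radius (L1 - mu1)|x - x1| around
    (L1 + mu1)(x - x1) meets the opposite of the ball of radius
    (L2 - mu2)|x - x2| around (L2 + mu2)(x - x2); two balls meet when the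
    distance of the centres is at most the sum of the radii, which is the
    stated inequality.

    Necessity of the ball condition ([gradient_in_ball]) is the cocoercivity
    of the gradient of f - (mu/2)|.|^2, obtained from the descent lemma
    ([descent]).  Before that, smoothness, which only speaks about pairs of
    subgradients, has to be shown to force finiteness and the existence of a
    subgradient everywhere ([exists_subgradient]): proximal points of a point z
    carry subgradients and converge to z, the Lipschitz condition makes the
    subgradients converge as well, and closedness of the epigraph passes to
    the limit.  The optimality condition g1 + g2 = 0 ([gradient_sum_eq0]) then
    comes from moving x slightly along - (g1 + g2).

    Sufficiency ([exists_classM_subgradient]) is explicit: a multiple of
    |y - z|^2 plus a multiple of the square of one linear form in y - z
    realizes every gradient in the ball. *)

(** * Euclidean geometry of row vectors *)

Section Euclidean.
Variables (R : realType) (n : nat).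
Implicit Types (x y z : 'rV[R]_n) (a : R).

Lemma dotC x y : dot x y = dot y x.
Proof. by apply: eq_bigr => i _; rewrite mulrC. Qed.

Lemma dotDl x y z : dot (x + y) z = dot x z + dot y z.
Proof. by rewrite -big_split; apply: eq_bigr => i _; rewrite mxE mulrDl. Qed.

Lemma dotZl a x y : dot (a *: x) y = a * dot x y.
Proof. by rewrite big_distrr; apply: eq_bigr => i _; rewrite /= mxE mulrA. Qed.

Lemma dotNl x y : dot (- x) y = - dot x y.
Proof. by rewrite -scaleN1r dotZl mulN1r. Qed.

Lemma dot0l y : dot 0 y = 0.
Proof. by rewrite -(scale0r 0) dotZl mul0r. Qed.

Lemma dotDr x y z : dot x (y + z) = dot x y + dot x z.
Proof. by rewrite dotC dotDl !(dotC x). Qed.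

Lemma dotZr a x y : dot x (a *: y) = a * dot x y.
Proof. by rewrite dotC dotZl (dotC x). Qed.

Lemma dotNr x y : dot x (- y) = - dot x y.
Proof. by rewrite dotC dotNl (dotC x). Qed.

Definition dotE := (dotDl, dotDr, dotZl, dotZr, dotNl, dotNr).

Lemma dot_ge0 x : 0 <= dot x x.
Proof. by apply: sumr_ge0 => i _; rewrite -expr2 sqr_ge0. Qed.

Lemma dot_eq0 x : (dot x x <= 0) -> x = 0.
Proof.
move=> x0; have {x0} : dot x x == 0 by rewrite eq_le x0 dot_ge0.
rewrite psumr_eq0 => [/allP h|i _]; last by rewrite -expr2 sqr_ge0.
apply/rowP => i; rewrite mxE; apply/eqP.
by have := h i (mem_index_enum i); rewrite /= mulf_eq0 orbb.
Qed.

Lemma enorm_ge0 x : 0 <= enorm x.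
Proof. exact: sqrtr_ge0. Qed.

Lemma enormE x : enorm x ^+ 2 = dot x x.
Proof. by rewrite sqr_sqrtr ?dot_ge0. Qed.

Lemma enorm_le x a : 0 <= a -> (enorm x <= a) = (dot x x <= a ^+ 2).
Proof. by move=> a0; rewrite -enormE ler_sqr // nnegrE enorm_ge0. Qed.

Lemma enormZ a x : enorm (a *: x) = `|a| * enorm x.
Proof. by rewrite /enorm !dotE mulrA -expr2 sqrtrM ?sqr_ge0// sqrtr_sqr. Qed.

Lemma enorm_distC x y : enorm (x - y) = enorm (y - x).
Proof. by rewrite -opprB -scaleN1r enormZ normrN1 mul1r. Qed.

Lemma cauchy_schwarz x y : dot x y <= enorm x * enorm y.
Proof.
have [x0|x0] := eqVneq (enorm x) 0.
  have -> : x = 0 by apply: dot_eq0; rewrite -enormE x0 expr0n.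
  by rewrite dot0l mulr_ge0// enorm_ge0.
have [y0|y0] := eqVneq (enorm y) 0.
  have -> : y = 0 by apply: dot_eq0; rewrite -enormE y0 expr0n.
  by rewrite dotC dot0l mulr_ge0// enorm_ge0.
have xy : 0 < enorm x * enorm y by rewrite mulr_gt0// lt0r ?x0 ?y0 enorm_ge0.
have := dot_ge0 (enorm y *: x - enorm x *: y).
rewrite !dotE (dotC y x) -!enormE => h; rewrite -(ler_pM2l xy); lra.
Qed.

Lemma ler_enormD x y : enorm (x + y) <= enorm x + enorm y.
Proof.
rewrite enorm_le ?addr_ge0 ?enorm_ge0//.
have := cauchy_schwarz x y; rewrite !dotE (dotC y x) -!enormE; nra.
Qed.

Lemma coord_le_enorm x i : `|x ord0 i| <= enorm x.
Proof.
rewrite -ler_sqr ?nnegrE ?enorm_ge0// enormE real_normK ?num_real//.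
rewrite expr2 /dot (bigD1 i)//= lerDl.
by apply: sumr_ge0 => k _; rewrite -expr2 sqr_ge0.
Qed.

Lemma mxnorm_le_enorm x : `|x| <= enorm x.
Proof.
rewrite [leLHS]mx_normrE; apply/bigmax_leP; split; first exact: enorm_ge0.
by move=> [i j] _ /=; rewrite (ord1 i) coord_le_enorm.
Qed.

End Euclidean.

(** * Limits and proximal points *)

Section Limits.
Variables (R : realType) (n : nat).
Implicit Types (x y z p w : 'rV[R]_n).

Lemma dot_cvg (T : Type) (F : set_system T) (FF : Filter F)
    (u v : T -> 'rV[R]_n) p w :
  u @ F --> p -> v @ F --> w -> dot (u t) (v t) @[t --> F] --> dot p w.
Proof.
move=> up vw; rewrite /dot; apply: (cvg_big (U := R^o) (@add_continuous R^o)) => i _.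
have coord (f : T -> 'rV[R]_n) (l : 'rV[R]_n) :
    f @ F --> l -> f t ord0 i @[t --> F] --> l ord0 i.
  move=> fl; apply: (@cvg_comp _ _ _ f (fun M : 'rV[R]_n => M ord0 i) _ _ _ fl).
  exact: coord_continuous.
by apply: cvgM; exact: coord.
Qed.

Lemma cvg_enorm_rate (u : nat -> 'rV[R]_n) y (C : R) :
  (forall k, enorm (u k - y) <= C * k.+1%:R^-1) -> u @ \oo --> y.
Proof.
move=> h; apply/subr_cvg0/norm_cvg0P/
  (@squeeze_cvgr _ _ _ _ (fun=> 0) (fun k => C * harmonic k)).
- by near=> k; rewrite normr_ge0 /= (le_trans (mxnorm_le_enorm _) (h k)).
- exact: cvg_cst.
- by rewrite -(mulr0 C); apply: cvgM; [exact: cvg_cst|exact: cvg_harmonic].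
Unshelve. all: by end_near. Qed.

Lemma cauchy_enorm_rate (u : nat -> 'rV[R]_n) (C : R) :
  (forall i j, enorm (u i - u j) <= C * (i.+1%:R^-1 + j.+1%:R^-1)) ->
  cvgn u.
Proof.
move=> h; apply/cauchy_cvgP/cauchy_exP => e e0.
have C0 : 0 <= C by have := le_trans (enorm_ge0 _) (h 0%N 0%N); lra.
have d0 : 0 < e / (2 * C + 1) by rewrite divr_gt0//; lra.
have [N _ hN] := near_infty_natSinv_lt (PosNum d0).
exists (u N); exists N => //= j Nj; rewrite -ball_normE /=.
apply: (le_lt_trans (le_trans (mxnorm_le_enorm _) (h N j))).
have C1 : 0 < 2 * C + 1 by lra.
have : N.+1%:R^-1 < e / (2 * C + 1) := hN N (leqnn N).
have : j.+1%:R^-1 < e / (2 * C + 1) := hN j Nj.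
rewrite !ltr_pdivlMr//.
have : 0 < N.+1%:R^-1 :> R by [].
have : 0 < j.+1%:R^-1 :> R by [].
move: (N.+1%:R^-1) (j.+1%:R^-1) => a b b0 a0 bC aC.
nra.
Qed.

(** A sublevel set of the objective, seen in the epigraph, is closed and lies in
    a box, because f is bounded below; on it the objective is the continuous
    function (y, r) |-> r + c |y - z|^2, although f is only lower
    semicontinuous.  The conclusion ranges over the epigraph, so that no
    extended real appears in it. *)
Lemma exists_prox_point (f : 'rV[R]_n -> \bar R) x1 (m c : R) z :
  closed_efun f -> (forall y, (m%:E <= f y)%E) -> (f x1 <= m%:E)%E -> 0 < c ->
  exists y r, (f y <= r%:E)%E /\
    forall w b, (f w <= b%:E)%E ->
      r + c * dot (y - z) (y - z) <= b + c * dot (w - z) (w - z).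
Proof.
move=> fcl fm fx1 c0.
pose q (p : 'rV[R]_n * R) : R := p.2 + c * dot (p.1 - z) (p.1 - z).
have qc : continuous q.
  move=> p; apply: cvgD; first exact: cvg_snd.
  apply: cvgM; first exact: cvg_cst.
  have pz : (t : 'rV[R]_n * R).1 - z @[t --> p] --> p.1 - z.
    by apply: cvgB; [exact: cvg_fst|exact: cvg_cst].
  exact: (@dot_cvg _ (nbhs p) _ (fun t => t.1 - z) (fun t => t.1 - z)).
pose M := q (x1, m).
pose D := enorm (x1 - z).
pose K := epigraph f `&` q @^-1` [set t | t <= M].
have Kcl : closed K.
  by apply: closedI => //; apply: preimage_closed => [p _|]; [exact: qc|exact: closed_le].
have Kco : compact K.
  (* x1 itself is a competitor, so the minimizer is no farther from z than x1. *)
  pose I i := `[z ord0 i - D, z ord0 i + D]%classic.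
  pose B := [set v : 'rV[R]_n | forall i, I i (v ord0 i)].
  have Bc : compact B by apply: (@rV_compact R n I) => i; exact: segment_compact.
  apply: (subclosed_compact Kcl (compact_setX Bc (@segment_compact _ m M))).
  move=> [y r] [/= fy qy].
  have mr : m <= r by rewrite -lee_fin (le_trans (fm y)).
  have y0 : 0 <= c * dot (y - z) (y - z) by rewrite mulr_ge0 ?dot_ge0 1?ltW.
  have yD : enorm (y - z) <= D.
    rewrite enorm_le ?enorm_ge0// enormE -(ler_pM2l c0).
    by move: qy; rewrite /M /q/=; lra.
  split => [i|]; rewrite /= ?/I/= in_itv/=.
    have := le_trans (coord_le_enorm (y - z) i) yD.
    by rewrite !mxE ler_norml; lra.
  by rewrite mr; move: qy; rewrite /q/=; lra.
have K0 : K !=set0 by exists (x1, m); split => /=.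
have [[y r] yK ymin] := compact_EVT_min K0 Kco (continuous_subspaceT qc).
move: yK; rewrite inE => -[/= fy qy]; exists y, r; split=> // w b fw.
have [wM|/ltW Mw] := leP (q (w, b)) M.
  by apply: (ymin (w, b)); rewrite inE; split.
exact: le_trans qy Mw.
Qed.

End Limits.

(** * Subgradients exist everywhere *)

Lemma ler_limit0 (R : realType) (a b c : R) :
  (forall t, 0 < t < 1 -> a <= b + t * c) -> a <= b.
Proof.
move=> h; rewrite leNgt; apply/negP => ba.
have c0 := normr_ge0 c; have cc := ler_norm c.
have d0 : 0 < 2 * (a - b + `|c|) by lra.
have : 0 < (a - b) / (2 * (a - b + `|c|)) < 1.
  by rewrite divr_gt0 ?ltr_pdivrMr//=; lra.
(* This t makes the gap a - b too large to be covered by t * c. *)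
set t := _ / _ => t01; have := h t t01.
have : t * (2 * (a - b + `|c|)) = a - b by rewrite divfK// gt_eqF.
case/andP: t01 => t0 _.
have : t * c <= t * `|c| by rewrite ler_pM2l.
have : 0 < t * (a - b) by rewrite mulr_gt0//; lra.
lra.
Qed.

Section Subgradients.
Variables (R : realType) (n : nat).
Implicit Types (f : 'rV[R]_n -> \bar R) (x y z p w : 'rV[R]_n).

Lemma subdifferential_epigraph f y p (r : R) :
  (forall x, f x != -oo%E) -> (f y <= r%:E)%E ->
  (forall w b, (f w <= b%:E)%E -> r + dot p (w - y) <= b) ->
  subdifferential f y p.
Proof.
move=> fNy fy h; have fyE : f y = r%:E.
  apply/eqP; rewrite eq_le fy /=.
  case fy' : (f y) => [s| |]; last 2 first.
  - by rewrite leey.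
  - by have := fNy y; rewrite fy'.
  have := h y s; rewrite fy' subrr dotC dot0l addr0 lexx lee_fin; exact.
split; first by rewrite /edom /= fyE ltry.
move=> w; rewrite fyE -EFinD.
case fw : (f w) => [s| |]; last 2 first.
- by rewrite leey.
- by have := fNy w; rewrite fw.
by rewrite lee_fin; apply: h; rewrite fw.
Qed.

Lemma convex_epigraph f x y (a b t : R) : convex_efun f -> 0 < t < 1 ->
  (f x <= a%:E)%E -> (f y <= b%:E)%E ->
  (f (t *: x + (1 - t) *: y)%R <= (t * a + (1 - t) * b)%R%:E)%E.
Proof.
move=> fcvx t01 fx fy; apply: (le_trans (fcvx x y t t01)).
case/andP: t01 => t0 t1; rewrite (EFinD (t * a)) !EFinM.
by apply: leeD; apply: lee_wpmul2l; rewrite // lee_fin; lra.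
Qed.

(** Compare y with the point y + t (w - y) of the segment towards w, divide by t
    and let t go to 0: the quadratic penalty leaves its gradient at y. *)
Lemma prox_subgradient f y z (r c : R) :
  (forall x, f x != -oo%E) -> convex_efun f -> (f y <= r%:E)%E ->
  (forall w b, (f w <= b%:E)%E ->
      r + c * dot (y - z) (y - z) <= b + c * dot (w - z) (w - z)) ->
  subdifferential f y ((2 * c) *: (z - y)).
Proof.
move=> fNy fcvx fy ymin; apply: (subdifferential_epigraph fNy fy) => w b fw.
apply: (@ler_limit0 _ _ _ (c * dot (w - y) (w - y))) => t t01.
have := ymin _ _ (convex_epigraph fcvx t01 fw fy).
have -> : t *: w + (1 - t) *: y - z = (y - z) + t *: (w - y).
  by apply/rowP => i; rewrite !mxE; ring.
case/andP: t01 => t0 _.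
have -> : z - y = - (y - z) by rewrite opprB.
rewrite !(dotDl (y - z)) !(dotDr _ (y - z)) !(dotZl,dotZr,dotNl,dotNr).
rewrite (dotC (w - y) (y - z)) => le_t; rewrite -(ler_pM2l t0); lra.
Qed.

(** Let y k be the proximal point of z for the penalty (k + 1)/2 |y - z|^2 and
    p k = (k + 1)(z - y k) its subgradient.  Since 0 is a subgradient at x1,
    monotonicity gives |y k - x1| <= |z - x1| and smoothness bounds p k, whence
    y k --> z at rate 1/(k + 1).  By smoothness again p is a Cauchy sequence,
    and its limit is a subgradient at z because the epigraph is closed.  The
    same passage to the limit, tested at x1, shows that f z is finite. *)
Lemma exists_subgradient f (mu L : R) x1 z : 0 <= L -> classM mu L%:E x1 f ->
  exists p, subdifferential f z p.
Proof.
move=> L0 [[fcl [fNy [a fa]] fcvx [//|fsm] _] fmin].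
have [m fx1] : exists m, f x1 = m%:E.
  case fx1 : (f x1) => [s| |]; first by exists s.
  - by have := le_lt_trans (fmin a) fa; rewrite fx1 ltxx.
  - by have := fNy x1; rewrite fx1.
have fm y : (m%:E <= f y)%E by rewrite -fx1.
have fx1m : (f x1 <= m%:E)%E by rewrite fx1.
have sub0 : subdifferential f x1 0.
  by split=> [|y]; rewrite /edom/= ?dot0l ?adde0// fx1 ltry.
have ex k : exists y, subdifferential f y (k.+1%:R *: (z - y)).
  have c0 : 0 < k.+1%:R / 2 :> R by rewrite divr_gt0.
  have [y [r [fy ymin]]] := exists_prox_point z fcl fm fx1m c0.
  exists y; have -> : k.+1%:R = 2 * (k.+1%:R / 2) :> R by rewrite mulrC divfK.
  exact: prox_subgradient ymin.
have [y ysub] := choice ex.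
pose p k := k.+1%:R *: (z - y k).
pose D := enorm (x1 - z).
have ybd k : enorm (y k - z) <= L * D * k.+1%:R^-1.
  have k0 : 0 < k.+1%:R :> R by [].
  have := fsm _ _ _ _ (ysub k) sub0; rewrite -EFinM lee_fin subr0 enormZ.
  rewrite gtr0_norm// enorm_distC ler_pdivlMr// mulrC => /le_trans; apply.
  rewrite ler_wpM2l// enorm_le ?enorm_ge0// enormE.
  have [_ /(_ x1)] := ysub k; rewrite fx1 => ys.
  have : 0 <= dot (z - y k) (y k - x1).
    have : ((f (y k)) + (dot (k.+1%:R *: (z - y k)) (x1 - y k))%R%:E <= f (y k))%E.
      by rewrite (le_trans ys)// -fx1.
    have : f (y k) \is a fin_num.
      rewrite fin_numElt ltNye fNy /=; exact: (ysub k).1.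
    move=> /fineK <-; rewrite -EFinD lee_fin gerDl dotZl pmulr_rle0//.
    by rewrite -(opprB (y k) x1) dotNr oppr_le0.
  have -> : x1 - z = - ((z - y k) + (y k - x1)) by apply/rowP => i; rewrite !mxE; ring.
  rewrite !(dotNl, dotNr) opprK (dotDl (z - y k)) !(dotDr _ (z - y k)).
  rewrite (dotC (y k - x1) (z - y k)).
  have := dot_ge0 (z - y k); lra.
have yz : y @ \oo --> z := cvg_enorm_rate ybd.
have /cvg_ex[q pq] : cvgn p.
  apply: (@cauchy_enorm_rate _ _ _ (L * (L * D))) => i j.
  have := fsm _ _ _ _ (ysub i) (ysub j); rewrite -EFinM lee_fin => /le_trans; apply.
  rewrite -mulrA ler_wpM2l// mulrDr.
  have -> : y i - y j = (y i - z) + (z - y j) by apply/rowP => k; rewrite !mxE; ring.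
  by rewrite (le_trans (ler_enormD _ _))// lerD// enorm_distC.
(* For w in the domain, (y k, b - <p k, w - y k>) lies in the epigraph. *)
have lim w b : (f w <= b%:E)%E -> (f z <= (b - dot q (w - z))%R%:E)%E.
  move=> fw.
  apply: (@closed_cvg _ _ \oo _ (fun k => (y k, b - dot (p k) (w - y k)))
    (epigraph f) fcl _ (z, b - dot q (w - z))).
    near=> k; rewrite /epigraph/=.
    have [_ /(_ w)/le_trans/(_ fw)] := ysub k.
    by rewrite EFinB leeBrDr.
  have wy : w - y k @[k --> \oo] --> w - z by apply: cvgB => //; exact: cvg_cst.
  have pwy : b - dot (p k) (w - y k) @[k --> \oo] --> b - dot q (w - z).
    by apply: cvgB; [exact: cvg_cst|exact: (@dot_cvg _ _ _ _ _ p (fun k => w - y k))].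
  exact: (cvg_pair yz pwy).
have [r fz] : exists r, f z = r%:E.
  have := lim x1 m; rewrite fx1 lexx => /(_ isT).
  case: (f z) (fm z) => [s| |]//; first by exists s.
exists q; apply: (@subdifferential_epigraph f z q r) => //; first by rewrite fz.
by move=> w b /lim; rewrite fz lee_fin lerBrDr.
Unshelve. all: by end_near. Qed.

(** What remains of the class F_(mu,L) once f is known to be real-valued with
    subgradient G y at each y: the strong convexity inequality
    at every point, and the Lipschitz condition. *)
Definition gradient_of (mu L : R) (F : 'rV[R]_n -> R) (G : 'rV[R]_n -> 'rV[R]_n) :=
  (forall y w, F y + dot (G y) (w - y) + mu / 2 * dot (w - y) (w - y) <= F w) /\
  (forall y w, enorm (G y - G w) <= L * enorm (y - w)).

Lemma exists_gradient f (mu L : R) x1 : 0 <= L -> classM mu L%:E x1 f ->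
  exists F G, [/\ forall y, f y = (F y)%:E, gradient_of mu L F G & G x1 = 0].
Proof.
move=> L0 fM; have [G Gsub] := choice (fun z => exists_subgradient z L0 fM).
case: fM => -[fcl [fNy _] fcvx [//|fsm] fstr] fmin.
have ffin y : f y \is a fin_num.
  by rewrite fin_numElt ltNye fNy /=; exact: (Gsub y).1.
have fE y : f y = (fine (f y))%:E by rewrite fineK.
exists (fine \o f), G; split=> //.
- split=> y w /=; last first.
    by have := fsm _ _ _ _ (Gsub y) (Gsub w); rewrite -EFinM lee_fin.
  apply: (@ler_limit0 _ _ _ (mu / 2 * dot (w - y) (w - y))) => t t01.
  have := fstr w y t t01.
  have -> : t *: w + (1 - t) *: y = y + t *: (w - y).
    by apply/rowP => i; rewrite !mxE; ring.
  have [_ /(_ (y + t *: (w - y)))] := Gsub y.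
  rewrite (fE y) (fE w) (fE (y + _)) -!(EFinB, EFinM, EFinD) !lee_fin.
  rewrite addrAC subrr add0r !enormE !dotE (dotC w y).
  move=> sub str; case/andP: t01 => t0 _; rewrite -(ler_pM2l t0); lra.
- have sub0 : subdifferential f x1 0.
    by split=> [|y]; [exact: (Gsub x1).1|rewrite dot0l adde0].
  have := fsm _ _ _ _ (Gsub x1) sub0; rewrite subrr subr0 -EFinM lee_fin.
  have -> : enorm (0 : 'rV[R]_n) = 0 by rewrite -(scale0r 0) enormZ normr0 mul0r.
  rewrite mulr0 enorm_le// expr0n; exact: dot_eq0.
Qed.

End Subgradients.

(** * Descent lemma and cocoercivity *)

Section Interpolation.
Variables (R : realType) (n : nat) (mu L : R).
Variables (F : 'rV[R]_n -> R) (G : 'rV[R]_n -> 'rV[R]_n).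
Hypotheses (mu0 : 0 <= mu) (muL : mu < L) (FG : gradient_of mu L F G).
Implicit Types x y z w : 'rV[R]_n.

Lemma gradient_lipschitz_dot y w v a : 0 <= a -> y - w = a *: v ->
  dot (G y - G w) v <= L * a * dot v v.
Proof.
move=> a0 yw; apply: (le_trans (cauchy_schwarz _ _)).
rewrite -enormE expr2 mulrA ler_wpM2r ?enorm_ge0//.
by rewrite (le_trans (FG.2 y w))// yw enormZ ger0_norm// mulrA.
Qed.

(** The integral-free proof of the descent lemma.  The gap F w - F y - <G y, w - y>
    is at most L |w - y|^2 by convexity and the Lipschitz condition.  If it is
    at most C |w - y|^2 for all pairs, then applying this to both halves of the
    segment [y, w] improves C to C/2 + L/4, a map with fixed point L/2; the
    excess over L/2 is halved at each step. *)
Lemma descent_bisection k y w :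
  F w <= F y + dot (G y) (w - y) + L / 2 * (1 + 2^-1 ^+ k) * dot (w - y) (w - y).
Proof.
elim: k y w => [|k IH] y w.
  have := FG.1 w y.
  have := @gradient_lipschitz_dot w y (w - y) 1 ler01 (esym (scale1r _)).
  have := mulr_ge0 mu0 (dot_ge0 (y - w)).
  rewrite expr0 -(opprB w y) !(dotNl, dotNr) dotDl dotNl.
  lra.
pose v := 2^-1 *: (w - y).
have v2 : w - y = v + v by apply/rowP => i; rewrite /v !mxE; field.
have e1 : y + v - y = v by rewrite addrC addKr.
have e2 : w - (y + v) = v by rewrite opprD addrA v2 addrK.
have := IH y (y + v); have := IH (y + v) w; rewrite e1 e2 v2.
have := @gradient_lipschitz_dot (y + v) y v 1 ler01.
rewrite scale1r => /(_ e1).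
rewrite exprS dotDl dotNl !(dotDr _ v v) dotDl.
move: (2^-1 ^+ k) => c; lra.
Qed.

Lemma descent y w :
  F w <= F y + dot (G y) (w - y) + L / 2 * dot (w - y) (w - y).
Proof.
apply: (@ler_limit0 _ _ _ (L / 2 * dot (w - y) (w - y))) => t /andP[t0 _].
have [k kt] : exists k, 2^-1 ^+ k <= t.
  exists (Num.bound t^-1); rewrite exprVn -[leRHS]invrK lef_pV2 ?posrE ?invr_gt0//.
  have t0' : 0 <= t^-1 by rewrite invr_ge0 ltW.
  rewrite (le_trans (ltW (archi_boundP t0')))// -natrX ler_nat ltnW//.
  exact: ltn_expl.
have L2 : 0 <= L / 2 * dot (w - y) (w - y).
  by rewrite mulr_ge0 ?dot_ge0// divr_ge0// (le_trans mu0 (ltW muL)).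
have := descent_bisection k y w; have := ler_wpM2r L2 kt.
by move: (2^-1 ^+ k) => c; lra.
Qed.

(** The point v below is a gradient step of length 1/(L - mu) from w for the
    function F - <G y, .> - (mu/2)|. - y|^2, which is minimal at y.  The descent
    lemma bounds F v above, strong convexity at y bounds it below. *)
Lemma bregman_lower_bound y w :
  let p := (G w - mu *: w) - (G y - mu *: y) in
  F y + dot (G y) (w - y) + mu / 2 * dot (w - y) (w - y)
    + dot p p / (2 * (L - mu)) <= F w.
Proof.
rewrite /=; set p := G w - mu *: w - (G y - mu *: y).
pose a := (L - mu)^-1; pose v := w - a *: p.
have aL : a * (L - mu) = 1 by rewrite mulVf// subr_eq0 gt_eqF.
have -> : dot p p / (2 * (L - mu)) = a / 2 * dot p p.
  by rewrite invfM /a; ring.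
have := FG.1 y v; have := descent w v.
have -> : v - w = - (a *: p) by rewrite /v addrC addKr.
have -> : v - y = (w - y) - a *: p by rewrite /v addrAC.
have pE : dot (G w) p = dot (G y) p + mu * dot (w - y) p + dot p p.
  have -> : G w = G y + mu *: (w - y) + p.
    by apply/rowP => i; rewrite /p !mxE; ring.
  by rewrite dotDl (dotDl (G y)) dotZl.
rewrite !(dotDr _ (w - y)) !(dotDl (w - y)) !(dotNl,dotNr,dotZl,dotZr) pE.
rewrite (dotC p (w - y)).
move: (dot p p) (dot (w - y) p) (dot (w - y) (w - y)) => P Q N.
have : a * (a * P) * (L - mu) = a * P by rewrite -[RHS]mul1r -aL; ring.
lra.
Qed.

(** Adding the lower bound for (y, w) and for (w, y) gives cocoercivity,
    <p, d> >= |p|^2 / (L - mu) for d = w - y and p = G w - G y - mu d; completing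
    the square turns this into a ball condition. *)
Lemma gradient_in_ball y w :
  enorm (2 *: (G w - G y) - (L + mu) *: (w - y)) <= (L - mu) * enorm (w - y).
Proof.
have M0 : 0 < L - mu by rewrite subr_gt0.
have := bregman_lower_bound y w; have := bregman_lower_bound w y => /=.
set p := (G w - mu *: w) - (G y - mu *: y).
have -> : G y - mu *: y - (G w - mu *: w) = - p by rewrite [RHS]opprB.
rewrite -(opprB w y) !(dotNl, dotNr) !opprK; set d := w - y.
have GE : G w - G y = p + mu *: d.
  by apply/rowP => i; rewrite /p /d !mxE; ring.
have GdE : dot (G w) d = dot (G y) d + dot p d + mu * dot d d.
  by rewrite -dotZl -addrA -dotDl -GE -dotDl addrC subrK.
rewrite GdE GE => lo1 lo2.
have cocoercive : dot p p / (L - mu) <= dot p d.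
  have : dot p p / (L - mu) = dot p p / (2 * (L - mu)) + dot p p / (2 * (L - mu)).
    by field; lra.
  lra.
have -> : 2 *: (p + mu *: d) - (L + mu) *: d = 2 *: p - (L - mu) *: d.
  by apply/rowP => i; rewrite !mxE; ring.
clearbody p d.
rewrite enorm_le ?mulr_ge0 ?enorm_ge0 ?(ltW M0)// exprMn enormE !dotE (dotC d p).
move: cocoercive; rewrite ler_pdivrMr// => /(ler_wpM2l (ler0n R 4)); lra.
Qed.

End Interpolation.

(** * Optimality condition for a sum *)

Section Sum.
Variables (R : realType) (n : nat) (mu1 L1 mu2 L2 : R).
Variables (F1 F2 : 'rV[R]_n -> R) (G1 G2 : 'rV[R]_n -> 'rV[R]_n).
Hypotheses (mu10 : 0 <= mu1) (mu20 : 0 <= mu2).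
Hypotheses (FG1 : gradient_of mu1 L1 F1 G1) (FG2 : gradient_of mu2 L2 F2 G2).

(** Move from x to y = x - t s with s = G1 x + G2 x.  The subgradient inequalities
    at y together with minimality of x give <G1 y + G2 y, s> <= 0, and by the
    Lipschitz conditions G1 y + G2 y differs from s by O(t). *)
Lemma gradient_sum_eq0 x : (forall y, F1 x + F2 x <= F1 y + F2 y) ->
  G1 x + G2 x = 0.
Proof.
move=> xmin; set s := G1 x + G2 x; apply: dot_eq0.
apply: (@ler_limit0 _ _ _ ((L1 + L2) * dot s s)) => t /andP[t0 _].
pose y := x - t *: s; have yx : x - y = t *: s by rewrite /y opprB addrC subrK.
have nng mu : 0 <= mu -> 0 <= mu / 2 * (t * (t * dot s s)).
  by move=> m0; rewrite !mulr_ge0 ?dot_ge0 // ltW.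
have := gradient_lipschitz_dot FG1 (ltW t0) yx.
have := gradient_lipschitz_dot FG2 (ltW t0) yx.
have := FG1.1 y x; have := FG2.1 y x; have := xmin y.
have := nng _ mu10; have := nng _ mu20.
rewrite yx !(dotZr t) !(dotZl t) (dotDl (G1 x)) (dotDl (G2 x))
  !(dotNl (G1 y), dotNl (G2 y)).
have ss : dot s s = dot (G1 x) s + dot (G2 x) s by rewrite -dotDl.
move=> h1 h2 h3 h4 h5 h6 h7.
have : t * (dot (G1 y) s + dot (G2 y) s) <= 0 by lra.
rewrite pmulr_rle0// ss; rewrite ss in h6 h7; lra.
Qed.

End Sum.

(** * Quadratic functions with a prescribed gradient *)

Section Quadratic.
Variables (R : realType) (n : nat) (mu c : R) (p z : 'rV[R]_n).
Hypotheses (mu0 : 0 <= mu) (c0 : 0 <= c).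

(** An isotropic part of curvature mu plus a part of rank one: the Hessian is
    mu I + c p p^T, whose largest eigenvalue is mu + c |p|^2. *)
Definition quad (y : 'rV[R]_n) : R :=
  mu / 2 * dot (y - z) (y - z) + c / 2 * dot p (y - z) ^+ 2.

Definition quad_grad (y : 'rV[R]_n) : 'rV[R]_n :=
  mu *: (y - z) + (c * dot p (y - z)) *: p.

Definition quad_form (v : 'rV[R]_n) : R :=
  mu / 2 * dot v v + c / 2 * dot p v ^+ 2.

Lemma quad_form_ge0 v : 0 <= quad_form v.
Proof. by rewrite addr_ge0// mulr_ge0 ?divr_ge0 ?dot_ge0 ?sqr_ge0. Qed.

Lemma quad_expansion y w :
  quad w = quad y + dot (quad_grad y) (w - y) + quad_form (w - y).
Proof.
rewrite /quad /quad_grad /quad_form.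
have -> : w - z = (y - z) + (w - y) by apply/rowP => i; rewrite !mxE; ring.
by move: (y - z) (w - y) => a b; rewrite !dotE (dotC b a); field.
Qed.

Lemma quad_ge y w : quad y + dot (quad_grad y) (w - y) <= quad w.
Proof. by rewrite (quad_expansion y w) lerDl quad_form_ge0. Qed.

(** Test the subgradient inequality in the direction s - quad_grad y with a small
    step: the quadratic remainder is of second order. *)
Lemma quad_grad_unique y s :
  subdifferential (EFin \o quad) y s -> s = quad_grad y.
Proof.
move=> [_ ys]; apply/eqP; rewrite -subr_eq0; apply/eqP/dot_eq0.
set v := s - quad_grad y.
apply: (@ler_limit0 _ _ _ (quad_form v)) => t /andP[t0 _].
have := ys (y + t *: v); rewrite /= -EFinD lee_fin (quad_expansion y (_ + _)).
have -> : y + t *: v - y = t *: v by rewrite addrC addKr.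
have -> : dot v v = dot s v - dot (quad_grad y) v by rewrite -dotNl -dotDl.
rewrite !(dotZr t) /quad_form !(dotZr t) (dotZl t) => h.
rewrite -(ler_pM2l t0); lra.
Qed.

Lemma quad_grad_lipschitz (L : R) y w : c * dot p p <= L - mu -> mu <= L ->
  enorm (quad_grad y - quad_grad w) <= L * enorm (y - w).
Proof.
move=> cp muL; have L0 := le_trans mu0 muL.
have -> : quad_grad y - quad_grad w =
    mu *: (y - w) + (c * dot p (y - w)) *: p.
  have -> : y - w = (y - z) - (w - z) by apply/rowP => i; rewrite !mxE; ring.
  rewrite /quad_grad; move: (y - z) (w - z) => a b; rewrite dotDr dotNr.
  by apply/rowP => i; rewrite !mxE; ring.
move: (y - w) => v.
have [cs1 cs2] : dot p v <= enorm p * enorm v /\ - dot p v <= enorm p * enorm v.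
  split; first exact: cauchy_schwarz.
  have -> : enorm p = enorm (- p) by rewrite -[in RHS]scaleN1r enormZ normrN1 mul1r.
  by rewrite -dotNl cauchy_schwarz.
have {cs1 cs2} cs : `|dot p v| <= enorm p * enorm v by rewrite ler_norml lerNl cs2.
apply: (le_trans (ler_enormD _ _)); rewrite !enormZ ger0_norm// normrM ger0_norm//.
have : c * `|dot p v| * enorm p <= c * (enorm p * enorm v) * enorm p.
  by rewrite ler_wpM2r ?enorm_ge0// ler_wpM2l.
have := ler_wpM2r (enorm_ge0 v) cp; rewrite -enormE; lra.
Qed.

(** Stated along an arbitrary filter, so that it applies to the first projection
    of a pair when the epigraph is shown to be closed. *)
Lemma quad_cvg (T : Type) (K : set_system T) (FK : Filter K)
    (u : T -> 'rV[R]_n) y : u @ K --> y -> quad (u t) @[t --> K] --> quad y.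
Proof.
move=> uy; have uz : u t - z @[t --> K] --> y - z.
  by apply: cvgB => //; exact: cvg_cst.
have puz : dot p (u t - z) @[t --> K] --> dot p (y - z).
  by apply: (@dot_cvg _ _ _ _ _ (fun=> p) (fun t => u t - z)) => //; exact: cvg_cst.
apply: cvgD; apply: cvgM; try exact: cvg_cst; last exact: cvgM.
exact: (@dot_cvg _ _ _ _ _ (fun t => u t - z) (fun t => u t - z)).
Qed.

Lemma quad_strong_convexity x y (t : R) :
  t * quad x + (1 - t) * quad y =
  quad (t *: x + (1 - t) *: y) + t * (1 - t) * quad_form (x - y).
Proof.
rewrite /quad /quad_form.
have -> : x - y = (x - z) - (y - z) by apply/rowP => i; rewrite !mxE; ring.
have -> : t *: x + (1 - t) *: y - z = t *: (x - z) + (1 - t) *: (y - z).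
  by apply/rowP => i; rewrite !mxE; ring.
by move: (x - z) (y - z) => a b; rewrite !dotE (dotC b a); field.
Qed.

Lemma quad_classM (L : R) : c * dot p p <= L - mu -> mu <= L ->
  classM mu L%:E z (EFin \o quad).
Proof.
move=> cp muL; split; last first.
  move=> y; rewrite lee_fin; suff -> : quad z = 0 by exact: (quad_form_ge0 (y - z)).
  by rewrite /quad subrr (dotC p) !dot0l expr0n !mulr0 addr0.
split.
- rewrite /closed_efun; have -> : epigraph (EFin \o quad) =
      (fun q : 'rV[R]_n * R => quad q.1 - q.2) @^-1` [set r | r <= 0].
    by apply/seteqP; split=> q; rewrite /epigraph/= lee_fin subr_le0.
  apply: preimage_closed => [q _|]; last exact: closed_le.
  apply: cvgB; last exact: cvg_snd.
  by apply: quad_cvg; exact: cvg_fst.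
- by split => [//|]; exists z; rewrite /edom/= ltry.
- move=> x y t /andP[t0 t1].
  rewrite /= -!EFinM -EFinD lee_fin quad_strong_convexity lerDl.
  by rewrite !mulr_ge0 ?quad_form_ge0 ?subr_ge0// ltW.
- right=> y w g h /quad_grad_unique -> /quad_grad_unique ->.
  by rewrite -EFinM lee_fin quad_grad_lipschitz.
- move=> x y t /andP[t0 t1].
  rewrite /= -!EFinB -!EFinM -EFinD lee_fin !enormE.
  have := quad_strong_convexity x y t; rewrite /quad_form.
  have : 0 <= t * (1 - t) * (c / 2 * dot p (x - y) ^+ 2).
    apply: mulr_ge0; last by apply: mulr_ge0; [exact: divr_ge0|exact: sqr_ge0].
    by rewrite mulr_ge0 ?subr_ge0 ?ltW.
  move: (dot p (x - y) ^+ 2) => s.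
  rewrite !dotE (dotC y x); lra.
Qed.

End Quadratic.

(** With d = x - z and p = g - mu d, the ball condition reads
    |p|^2 <= (L - mu) <p, d>.  The quadratic with direction p and
    c = 1 / <p, d> has gradient mu d + p = g at x, and the condition says
    exactly that its largest eigenvalue mu + c |p|^2 is at most L. *)
Lemma exists_classM_subgradient (R : realType) n (mu L : R) (x z g : 'rV[R]_n) :
  0 <= mu -> mu < L ->
  enorm (2 *: g - (L + mu) *: (x - z)) <= (L - mu) * enorm (x - z) ->
  exists2 q : 'rV[R]_n -> R, classM mu L%:E z (EFin \o q) &
    forall y, q x + dot g (y - x) <= q y.
Proof.
move=> mu0 muL; have M0 : 0 < L - mu by rewrite subr_gt0.
set d := x - z; pose p := g - mu *: d.
have -> : 2 *: g - (L + mu) *: d = 2 *: p - (L - mu) *: d.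
  by apply/rowP => i; rewrite /p !mxE; ring.
rewrite enorm_le ?mulr_ge0 ?enorm_ge0 ?(ltW M0)// exprMn enormE.
rewrite !(dotDl (2 *: p)) !(dotDr _ (2 *: p))
  !(dotNl, dotNr, dotZl, dotZr) (dotC d p) => ball.
have {ball} pd : dot p p <= (L - mu) * dot p d by lra.
have pd0 : 0 <= dot p d by rewrite -(pmulr_rge0 _ M0) (le_trans (dot_ge0 p)).
pose c := (dot p d)^-1.
have c0 : 0 <= c by rewrite invr_ge0.
(* If <p, d> = 0 then p = 0, and c = 0 by the convention for 0^-1. *)
have [cp cpd] : c * dot p p <= L - mu /\ (c * dot p d) *: p = p.
  have [pd_eq0|pd_neq0] := eqVneq (dot p d) 0.
    have -> : p = 0 by apply: dot_eq0; rewrite (le_trans pd)// pd_eq0 mulr0.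
    by rewrite dot0l mulr0 scaler0; split=> //; exact: ltW.
  rewrite /c mulVf// scale1r; split=> //.
  by rewrite mulrC ler_pdivrMr// lt0r pd_neq0.
exists (quad mu c p z); first exact: quad_classM (ltW muL).
have -> : g = quad_grad mu c p z x.
  by rewrite /quad_grad cpd /p addrC subrK.
by move=> y; apply: quad_ge.
Qed.

(** The witness divides the segment from a1 to - a2 in the ratio r1 : r2.  When both
    radii vanish the ratio is 0 by convention, and a1 + a2 = 0. *)
Lemma split_between_balls (R : realType) n (a1 a2 : 'rV[R]_n) (r1 r2 : R) :
  0 <= r1 -> 0 <= r2 -> enorm (a1 + a2) <= r1 + r2 ->
  exists g : 'rV[R]_n, enorm (2 *: g - a1) <= r1 /\ enorm (2 *: (- g) - a2) <= r2.
Proof.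
move=> r10 r20 h; pose s := r1 / (r1 + r2).
exists (2^-1 *: (a1 - s *: (a1 + a2))).
have -> : 2 *: (2^-1 *: (a1 - s *: (a1 + a2))) - a1 = - s *: (a1 + a2).
  by apply/rowP => i; rewrite !mxE; field.
have -> : 2 *: - (2^-1 *: (a1 - s *: (a1 + a2))) - a2 = (s - 1) *: (a1 + a2).
  by apply/rowP => i; rewrite !mxE; field.
rewrite !enormZ normrN distrC.
have [r0|r0] := eqVneq (r1 + r2) 0.
  have -> : enorm (a1 + a2) = 0 by apply/eqP; rewrite eq_le enorm_ge0 -r0 h.
  by rewrite !mulr0.
have rp : 0 < r1 + r2 by rewrite lt0r r0 addr_ge0.
have s0 : 0 <= s by rewrite divr_ge0// ltW.
have s1 : 1 - s = r2 / (r1 + r2) by rewrite /s; field.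
have s10 : 0 <= 1 - s by rewrite s1 divr_ge0// ltW.
rewrite !ger0_norm//; split.
  by rewrite (le_trans (ler_wpM2l s0 h))// /s divfK.
by rewrite (le_trans (ler_wpM2l s10 h))// s1 divfK.
Qed.

(** * The minimizers of a sum *)

Theorem mainTheorem1 (R : realType) (n : nat) (mu1 L1 mu2 L2 : R)
    (hmu1 : 0 <= mu1) (hL1 : mu1 < L1) (hmu2 : 0 <= mu2) (hL2 : mu2 < L2)
    (x1 x2 x : 'rV[R]_n) :
  (exists f1 f2 : 'rV[R]_n -> \bar R,
      [/\ classM mu1 L1%:E x1 f1, classM mu2 L2%:E x2 f2 &
          minimizer (fun y => (f1 y + f2 y)%E) x])
  <->
  enorm ((L1 + mu1) *: (x - x1) + (L2 + mu2) *: (x - x2)) <=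
    (L1 - mu1) * enorm (x - x1) + (L2 - mu2) * enorm (x - x2).
Proof.
split=> [[f1 [f2 [f1M f2M xmin]]]|ineq].
  have [F1 [G1 [f1E FG1 G1x1]]] := exists_gradient (le_trans hmu1 (ltW hL1)) f1M.
  have [F2 [G2 [f2E FG2 G2x2]]] := exists_gradient (le_trans hmu2 (ltW hL2)) f2M.
  have G12 : G1 x + G2 x = 0.
    apply: (gradient_sum_eq0 hmu1 hmu2 FG1 FG2) => y.
    by have := xmin y; rewrite !f1E !f2E -!EFinD lee_fin.
  have := gradient_in_ball hmu1 hL1 FG1 x1 x.
  have := gradient_in_ball hmu2 hL2 FG2 x2 x.
  rewrite G1x1 G2x2 !subr0 => ball2 ball1.
  apply: le_trans (lerD ball1 ball2); rewrite -[leLHS]mul1r -normrN1 -enormZ.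
  apply: le_trans (ler_enormD _ _).
  rewrite addrACA -scalerDr G12 scaler0 add0r scaleN1r opprD; exact: lexx.
have [||g [ball1 ball2]] := split_between_balls _ _ ineq.
- by rewrite mulr_ge0 ?enorm_ge0// subr_ge0 ltW.
- by rewrite mulr_ge0 ?enorm_ge0// subr_ge0 ltW.
have [q1 q1M q1g] := exists_classM_subgradient hmu1 hL1 ball1.
have [q2 q2M q2g] := exists_classM_subgradient hmu2 hL2 ball2.
exists (EFin \o q1), (EFin \o q2); split=> // y.
rewrite /= -!EFinD lee_fin; have := q1g y; have := q2g y; rewrite dotNl; lra.
Qed.
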